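(* Let $p$ be a prime number, let $k$ be a positive integer, and let $n_k$ be a positive integer such that $p\nmid n_k$ and $p^k\mid a_{n_k}$. Put $$q_{n_k,p} := a_{n_k+p}-a_{n_k}(n_k+p)^{n_k+2}\,n_k^{\,p-n_k-2}\in\mathbb{Q}.$$ Then: (i) if $q_{n_k,p}\not\equiv 0 \pmod{p^2}$, then there exists a positive integer $n_{k+1}$, unique modulo $p^{k+1}$, for which $p^{k+1}\mid a_{n_{k+1}}$ and $n_{k+1}\equiv n_k \pmod{p^k}$; that is, there is exactly one residue class modulo $p^{k+1}$ such that a positive integer $n\equiv n_k \pmod{p^k}$ satisfies $p^{k+1}\mid a_n$ if and only if $n$ belongs to this class; (ii) if $q_{n_k,p}\equiv 0 \pmod{p^2}$ and $p^{k+1}\mid a_{n_k}$, then $p^{k+1}\mid a_{n_{k+1}}$ for every positive integer $n_{k+1}$ satisfying $n_{k+1}\equiv n_k \pmod{p^k}$; (iii) if $q_{n_k,p}\equiv 0 \pmod{p^2}$ and $p^{k+1}\nmid a_{n_k}$, then $p^{k+1}\nmid a_{n_{k+1}}$ for every positive integer $n_{k+1}$ satisfying $n_{k+1}\equiv n_k \pmod{p^k}$. Moreover, let $n_1$ be a positive integer with $p\nmid n_1$ and $p\mid a_{n_1}$, and suppose that $$q_{n_1,p} := a_{n_1+p}-a_{n_1}(n_1+p)^{n_1+2}\,n_1^{\,p-n_1-2}\not\equiv 0 \pmod{p^2}.$$ Then for every positive integer $k$ the inequality $v_p(a_n)\geq k$ has a unique solution $n_k$ modulo $p^k$ satisfying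 $n_k\equiv n_1 \pmod p$; that is, there is exactly one residue class modulo $p^k$ such that a positive integer $n\equiv n_1 \pmod p$ satisfies $v_p(a_n)\geq k$ if and only if $n$ belongs to this class.
   Context: For a positive integer $n$, the Schenker sum is $a_n = \sum_{j=0}^{n}\frac{n!}{j!}n^j$ (a positive integer). For a prime $p$, $v_p$ denotes the $p$-adic valuation on $\mathbb{Q}$, with $v_p(0)=+\infty$. Convention: for rational numbers $x,y$, a prime $p$ and an integer $k$, the expression $x\equiv y \pmod{p^k}$ means $v_p(x-y)\geq k$ (this is needed because the exponent $p-n-2$ in $q_{n,p}$ may be negative, so $q_{n,p}$ is in general a rational number). *)

(* Defs.v *)
From mathcomp Require Import all_boot all_order all_algebra.
From mathcomp Require Import constructive_ereal.
Set Implicit Arguments.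
Unset Strict Implicit.
Unset Printing Implicit Defensive.
Import Order.TTheory GRing.Theory Num.Theory.

(* The division is exact because j <= n. *)
Definition schenker (n : nat) : nat := \sum_(j < n.+1) n`! %/ j`! * n ^ j.

Local Open Scope ring_scope.

Definition padic_val (p : nat) (x : rat) : \bar int :=
  if x == 0 then +oo%E
  else ((logn p `|numq x|)%:Z - (logn p `|denq x|)%:Z)%:E.

Definition eqmod_rat (p : nat) (k : int) (x y : rat) : bool :=
  (k%:E <= padic_val p (x - y))%E.

(* The last exponent is an integer, possibly negative. *)
Definition schenker_q (n p : nat) : rat :=
  (schenker (n + p))%:R
  - (schenker n)%:R * (n + p)%:R ^+ (n + 2)
    * n%:R ^ (p%:Z - n%:Z - 2%:Z).

(* Main.v *)
Require Import Defs.
From mathcomp Require Import all_boot all_order all_algebra.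
From mathcomp Require Import constructive_ereal.
From mathcomp Require Import ring.

Set Implicit Arguments.
Unset Strict Implicit.
Unset Printing Implicit Defensive.
Import Order.TTheory GRing.Theory Num.Theory.
Local Open Scope ring_scope.

(** Write x^_i for the falling factorial x(x-1)...(x-i+1). Reversing the
    order of summation, a_n = n^n * f(n) with f(x) = sum_i x^_i / x^i, where
    the sum stops at i = n because n^_i = 0 beyond. Since i! divides n^_i, the
    terms with i >= k * p vanish modulo p^k for every n, so that up to a unit
    a_n is, modulo p^k and on the integers prime to p, a polynomial in n:
    with P_N(x) = sum_(i <= N) x^_i x^(N-i) one has
      n^N a_n = n^n P_N(n)  modulo p^k  whenever k * p <= N
    ([schenker_trunc_congr]). The divisibility p^k | a_n is therefore the
    divisibility p^k | P_N(n), to which Hensel's lifting applies: if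
    P_N(n0) = p^k b then P_N(n0 + p^k t) = p^k (b + t P_N'(n0)) modulo
    p^(k+1), so everything depends on whether P_N'(n0) is invertible modulo p
    ([schenker_hensel]).

    The number q detects exactly this. When p | a_n, the correcting power
    (n+p)^(n+2) n^(p-n-2) only matters modulo p, and it was chosen so that q
    is, modulo p^2, a unit times P_N(n+p) - P_N(n), that is p P_N'(n) times a
    unit. Hence p^2 | q iff p | P_N'(n) ([schenker_q_deriv]). If q is nonzero
    modulo p^2, the linear congruence b + t P_N'(n0) = 0 has one solution t
    modulo p ([unique_lift]); otherwise b alone decides, for all t at once
    ([schenker_dvd_constant]). The last assertion follows by induction on k,
    as the criterion on P_N' shows that the condition on q depends only on n
    modulo p ([eqmod_schenker_q_congr]). *)

(** * Congruences between naturals and integers *)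

Lemma PoszX_nat (p k : nat) : (p ^ k)%:Z = p%:Z ^+ k.
Proof. by rewrite -natz natrX natz. Qed.

Lemma dvdn_intX (p k m : nat) : (p ^ k %| m)%N = (p%:Z ^+ k %| m%:Z)%Z.
Proof. by rewrite dvdzE abszX. Qed.

Lemma eqn_mod_dvdz (d m n : nat) :
  m = n %[mod d] <-> (d%:Z %| m%:Z - n%:Z)%Z.
Proof.
rewrite -eqz_mod_dvd !modz_nat; split=> [->|] //.
by move/eqP=> [].
Qed.

Lemma eqn_mod_shift (d n m : nat) : n = m %[mod d] ->
  exists t : int, n%:Z = m%:Z + d%:Z * t.
Proof.
move/eqn_mod_dvdz/dvdzP=> [t E]; exists t.
by rewrite mulrC -E addrC subrK.
Qed.

Lemma eqn_mod_ndvd (p n m : nat) : n = m %[mod p] -> ~~ (p %| m)%N ->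
  ~~ (p %| n)%N.
Proof. by rewrite /dvdn => ->. Qed.

Lemma eqn_modX1 (p k n m : nat) : (0 < k)%N -> n = m %[mod p ^ k] ->
  n = m %[mod p].
Proof.
move=> k0 /eqn_mod_dvdz nm; apply/eqn_mod_dvdz; apply: dvdz_trans nm.
by rewrite dvdzE /= dvdn_exp.
Qed.

Lemma dvdz_congr (d a b : int) : (d %| a - b)%Z -> (d %| a)%Z = (d %| b)%Z.
Proof. by move=> dab; rewrite -[a](subrK b) rpredDl. Qed.

Lemma coprimez_prime (p n : nat) (k : nat) : prime p -> ~~ (p %| n)%N ->
  coprimez (p%:Z ^+ k) n%:Z.
Proof.
by move=> p_pr pn; apply: coprimezXl; rewrite coprimezE /= prime_coprime.
Qed.

(** * First-order expansions over the integers *)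

(** The remainder is integral because the divided derivatives P^(i) / i! have
    integer coefficients. *)
Lemma int_taylor1 (P : {poly int}) (x h : int) :
  exists c, P.[x + h] = P.[x] + h * P^`().[x] + h ^+ 2 * c.
Proof.
exists (\sum_(i < size P) P^`N(i.+2).[x] * h ^+ i).
have := @nderiv_taylor_wide _ (size P).+2 P x h (mulrC x h).
move=> -> //; last by rewrite -addn2 leq_addr.
rewrite big_ord_recl big_ord_recl /= nderivn0 expr0 mulr1 nderivn1 expr1.
rewrite addrA; congr (_ + _); first by rewrite [h * _]mulrC.
rewrite mulr_sumr; apply: eq_bigr => i _.
by rewrite /= /bump /= !add1n !exprS; ring.
Qed.

Lemma horner_congr (P : {poly int}) (d x t : int) :
  (d %| P.[x + d * t] - P.[x])%Z.
Proof.
have [c ->] := int_taylor1 P x (d * t); set A := _.[_]; set B := _.[_].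
by apply/dvdzP; exists (t * B + t ^+ 2 * d * c); ring.
Qed.

Lemma intX_shift (x d : int) (e : nat) : exists u, (x + d) ^+ e = x ^+ e + d * u.
Proof.
have := subrXX (x + d) x e; rewrite addrAC subrr add0r => E.
by eexists; rewrite -[LHS](subrK (x ^+ e)) E addrC.
Qed.

(** * Valuations of rationals with denominator prime to p *)

(** The rational q has a denominator which is a power of n, hence prime to p;
    clearing it turns its valuation into an integer divisibility. *)
Lemma padic_val_ge (p d : nat) (x : rat) (z : int) (k : nat) : prime p ->
  ~~ (p %| d)%N -> x * d%:R = z%:~R ->
  (k%:Z%:E <= padic_val p x)%E = (p%:Z ^+ k %| z)%Z.
Proof.
move=> p_pr pd xd; rewrite /padic_val.
have d0 : d != 0%N by apply: contraNneq pd => ->; rewrite dvdn0.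
case: eqVneq xd => [->|x0] xd.
  rewrite leey; symmetry; move/eqP: xd; rewrite mul0r eq_sym intr_eq0 => /eqP ->.
  exact: dvdz0.
have E : numq x * d%:Z = z * denq x.
  apply: (@intr_inj rat); rewrite !rmorphM /= -xd -{2}[x]divq_num_den.
  by field; rewrite intr_eq0 denq_neq0.
have z0 : z != 0.
  apply/eqP=> z0; move/eqP: E; rewrite z0 mul0r mulf_eq0 numq_eq0 (negPf x0) /=.
  by rewrite eqz_nat (negPf d0).
have /(congr1 (logn p)) : (`|numq x| * d = `|z| * `|denq x|)%N.
  by have := congr1 absz E; rewrite !abszM.
rewrite !lognM ?absz_gt0 ?numq_eq0 ?denq_neq0 ?lt0n //.
rewrite (@logn_coprime p d) ?prime_coprime // addn0 => ->.
rewrite PoszD addrK lee_fin lez_nat.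
by rewrite dvdzE abszX pfactor_dvdn // absz_gt0.
Qed.

Lemma padic_val_nat_ge (p m k : nat) : prime p ->
  (k%:Z%:E <= padic_val p m%:R)%E = (p ^ k %| m)%N.
Proof.
move=> p_pr; rewrite (@padic_val_ge p 1 _ m%:Z) ?dvdn1 ?dvdn_intX //.
  by case: p p_pr => [|[]].
by rewrite mulr1.
Qed.

(** * Schenker sums as values of polynomials *)

Definition falling_poly (i : nat) : {poly int} := \prod_(l < i) ('X - (l%:Z)%:P).

Lemma horner_falling_poly i n : (falling_poly i).[n%:Z] = (n ^_ i)%:Z.
Proof.
elim: i => [|i IH]; first by rewrite /falling_poly big_ord0 hornerC.
rewrite /falling_poly big_ord_recr hornerM [X in X * _]IH ffactnSr PoszM /=.
rewrite hornerXsubC; case: (leqP i n) => [le_in|lt_ni]; first by rewrite subzn.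
by rewrite ffact_small // !mul0r.
Qed.

(** The truncation of f(x) = sum_i x^_i / x^i after the term i = m, with its
    denominators cleared by x^m. *)
Definition trunc_poly (m : nat) : {poly int} :=
  \sum_(i < m.+1) falling_poly i * 'X^(m - i).

Lemma trunc_polyS m : trunc_poly m.+1 = 'X * trunc_poly m + falling_poly m.+1.
Proof.
rewrite /trunc_poly big_ord_recr /= subnn expr0 mulr1; congr (_ + _).
rewrite mulr_sumr; apply: eq_bigr => i _.
by rewrite subSn ?leq_ord // exprS mulrCA.
Qed.

(** The substitution i = n - j in the Schenker sum, as n! / (n - i)! = n^_i. *)
Lemma schenker_trunc n : (schenker n)%:Z = (trunc_poly n).[n%:Z].
Proof.
rewrite /schenker /trunc_poly horner_sum (reindex_inj rev_ord_inj) /=.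
rewrite -natz natr_sum; apply: eq_bigr => i _.
rewrite hornerM horner_falling_poly hornerXn subSS ffact_factd ?leq_ord //.
by rewrite natrM natrX !natz.
Qed.

(** Raising the order by one multiplies the truncation by x and adds one
    falling factorial, which vanishes modulo d. The modulus d = 0 is allowed
    and will be used: it turns the congruence into an equality. *)
Lemma trunc_stable (d : int) (n m r : nat) :
  (forall i, (m < i)%N -> (d %| (n ^_ i)%:Z)%Z) ->
  (d %| (trunc_poly (m + r)).[n%:Z] - n%:Z ^+ r * (trunc_poly m).[n%:Z])%Z.
Proof.
move=> dff; elim: r => [|r IH]; first by rewrite addn0 expr0 mul1r subrr dvdz0.
rewrite addnS trunc_polyS hornerD hornerM hornerX horner_falling_poly exprS.
rewrite addrAC -mulrA -mulrBr rpredD ?dvdz_mull //.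
by apply: dff; rewrite ltnS leq_addr.
Qed.

Lemma dvdn_fact_le m n : (m <= n)%N -> (m`! %| n`!)%N.
Proof. by move=> le_mn; rewrite (fact_split le_mn) dvdn_mulr. Qed.

Lemma dvdn_fact_mul p k : (0 < p)%N -> (p ^ k %| (k * p)`!)%N.
Proof.
case: p => // p _; elim: k => // k IH.
rewrite mulSn addSn factS expnS dvdn_mul //.
  by rewrite -addSn -mulSn dvdn_mull.
by apply: dvdn_trans IH _; rewrite dvdn_fact_le ?leq_addl.
Qed.

Lemma dvdn_ffact p k n i : (0 < p)%N -> (k * p <= i)%N -> (p ^ k %| n ^_ i)%N.
Proof.
move=> p0 le_kpi; rewrite -bin_ffact dvdn_mull //.
exact: dvdn_trans (dvdn_fact_mul k p0) (dvdn_fact_le le_kpi).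
Qed.

(** Both terms are compared with the value at n of the truncation of order
    n + N: extending the order from n changes nothing since n^_i = 0 for i > n,
    and extending it from N changes nothing modulo p^k since p^k | n^_i for
    i > N. *)
Lemma schenker_trunc_congr (p k N n : nat) : (0 < p)%N -> (k * p <= N)%N ->
  (p%:Z ^+ k %| n%:Z ^+ N * (schenker n)%:Z
                - n%:Z ^+ n * (trunc_poly N).[n%:Z])%Z.
Proof.
move=> p0 kpN.
have : (0 %| (trunc_poly (n + N)).[n%:Z] - n%:Z ^+ N * (schenker n)%:Z)%Z.
  rewrite schenker_trunc; apply: trunc_stable => i ni.
  by rewrite ffact_small.
rewrite dvd0z subr_eq0 => /eqP <-; rewrite addnC.
apply: trunc_stable => i Ni; rewrite -dvdn_intX dvdn_ffact //.
exact: leq_trans kpN (ltnW Ni).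
Qed.

Lemma dvdz_schenker_trunc (p k N n : nat) : prime p -> ~~ (p %| n)%N ->
  (k * p <= N)%N ->
  (p ^ k %| schenker n)%N = (p%:Z ^+ k %| (trunc_poly N).[n%:Z])%Z.
Proof.
move=> p_pr pn kpN; rewrite dvdn_intX.
have cop e : coprimez (p%:Z ^+ k) (n%:Z ^+ e).
  exact/coprimezXr/coprimez_prime.
rewrite -(Gauss_dvdzr _ (cop N)) -[RHS](Gauss_dvdzr _ (cop n)).
exact: dvdz_congr (schenker_trunc_congr n (prime_gt0 p_pr) kpN).
Qed.

(** * The meaning of q *)

(** Modulo p^2, after multiplication by units, q becomes
    (n+p)^(n+p) n^(N+n+2) P(n+p) - n^n (n+p)^(N+n+2) n^p P(n), with P the
    truncation of order N. As p divides P(n) and P(n+p), their cofactors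
    matter only modulo p, and there both equal n^(2n+N+2+p); the difference is
    thus a unit times P(n+p) - P(n), that is a unit times p P'(n). The order 2p
    is what the modulus p^2 requires. *)
Lemma schenker_q_deriv (p N n : nat) : prime p -> ~~ (p %| n)%N ->
  (p %| schenker n)%N -> (2 * p <= N)%N ->
  eqmod_rat p 2 (schenker_q n p) 0 = (p%:Z %| (trunc_poly N)^`().[n%:Z])%Z.
Proof.
move=> p_pr pn pa pN.
have p0 : p%:Z != 0 by rewrite eqz_nat -lt0n prime_gt0.
have n0 : n%:R != 0 :> rat.
  by rewrite pnatr_eq0; apply: contraNneq pn => ->; rewrite dvdn0.
have copn e k : coprimez (p%:Z ^+ k) (n%:Z ^+ e).
  exact/coprimezXr/coprimez_prime.
have pnp : ~~ (p %| n + p)%N by rewrite dvdn_addl.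
have copnp e k : coprimez (p%:Z ^+ k) ((n + p)%:Z ^+ e).
  exact/coprimezXr/coprimez_prime.
(* q * n^(n+2), an integer as the exponent p - n - 2 becomes p. *)
set Z : int := (schenker (n + p))%:Z * n%:Z ^+ (n + 2)
  - (schenker n)%:Z * (n + p)%:Z ^+ (n + 2) * n%:Z ^+ p.
rewrite /eqmod_rat subr0 (@padic_val_ge p (n ^ (n + 2)) _ Z) //; first last.
- rewrite /schenker_q /Z natrX mulrBl !rmorphB !rmorphM /= !rmorphXn /= -!pmulrn.
  have -> : p%:Z - n%:Z - 2%:Z = p%:Z - (n + 2)%N%:Z by rewrite PoszD opprD addrA.
  by rewrite expfzDr // -exprnN mulrA mulfVK // expf_neq0.
- by rewrite Euclid_dvdX // (negPf pn).
have [c Ec] := int_taylor1 (trunc_poly N) n%:Z p%:Z.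
have /dvdzP[b Eb] : (p%:Z %| (trunc_poly N).[n%:Z])%Z.
  rewrite -[p%:Z]expr1 -(@dvdz_schenker_trunc p 1) ?expn1 //.
  by apply: leq_trans pN; rewrite leq_mul2r orbT.
have /dvdzP[al Ea] := schenker_trunc_congr (n + p) (prime_gt0 p_pr) pN.
have /dvdzP[be Ebe] := schenker_trunc_congr n (prime_gt0 p_pr) pN.
rewrite PoszD Ec in Ea.
move: (trunc_poly N)^`().[n%:Z] Ec Ea => D Ec Ea.
rewrite -(Gauss_dvdzr _ (copn N 2%N)) -(Gauss_dvdzr _ (copnp N 2%N)).
rewrite /Z PoszD; move: (n%:Z) Eb Ea Ebe copn Ec => X Eb Ea Ebe copn Ec.
set Y := X + p%:Z.
(* With P(n) = b p and P'(n) = D, the integer p W is what remains of q modulo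
   p^2, up to units, once Taylor's formula is applied to P(n+p). *)
pose W := Y ^+ (n + p) * (b + D) * X ^+ (n + 2 + N)
          - X ^+ n * b * Y ^+ (n + 2 + N) * X ^+ p.
transitivity (p%:Z ^+ 2 %| p%:Z * W)%Z.
  apply: dvdz_congr; apply/dvdzP; rewrite /W -/Y.
  move: Ea Ebe; rewrite Eb -/Y => /eqP; rewrite subr_eq => /eqP Ea.
  move=> /eqP; rewrite subr_eq => /eqP Eb'.
  exists (al * X ^+ (n + 2) * X ^+ N - be * Y ^+ (n + 2) * X ^+ p * Y ^+ N
          + Y ^+ (n + p) * c * X ^+ (n + 2 + N)).
  have -> : Y ^+ N * (X ^+ N * ((schenker (n + p))%:Z * X ^+ (n + 2)
     - (schenker n)%:Z * Y ^+ (n + 2) * X ^+ p)) =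
     (Y ^+ N * (schenker (n + p))%:Z) * X ^+ (n + 2) * X ^+ N
   - (X ^+ N * (schenker n)%:Z) * Y ^+ (n + 2) * X ^+ p * Y ^+ N by ring.
  by rewrite Ea Eb' !exprD; ring.
rewrite expr2 dvdz_mul2l //.
rewrite -[RHS](Gauss_dvdzr (n := X ^+ (n + p + (n + 2 + N)))); last first.
  by have := copn (n + p + (n + 2 + N))%N 1%N; rewrite expr1.
apply: dvdz_congr; apply/dvdzP; rewrite /W.
have [u Eu] := intX_shift X p%:Z (n + p).
have [v Ev] := intX_shift X p%:Z (n + 2 + N).
exists (u * (b + D) * X ^+ (n + 2 + N) - X ^+ n * b * v * X ^+ p).
by rewrite /Y Eu Ev !exprD; ring.
Qed.

Lemma eqn_mod_schenker_dvd (p m n : nat) : prime p -> ~~ (p %| m)%N ->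
  n = m %[mod p] -> (p %| schenker n)%N = (p %| schenker m)%N.
Proof.
move=> p_pr pm nm; have pn := eqn_mod_ndvd nm pm.
have [t Et] := eqn_mod_shift nm.
have E x : ~~ (p %| x)%N ->
    (p %| schenker x)%N = (p%:Z %| (trunc_poly (1 * p)).[x%:Z])%Z.
  move=> px; rewrite -[X in (X %| _)%N]expn1.
  by rewrite (@dvdz_schenker_trunc p 1 (1 * p)) ?expr1.
rewrite !E //; apply: dvdz_congr; rewrite Et.
exact: horner_congr.
Qed.

(** By [schenker_q_deriv], the condition is on the residue modulo p of a
    polynomial in n. *)
Lemma eqmod_schenker_q_congr (p m n : nat) : prime p -> ~~ (p %| m)%N ->
  (p %| schenker m)%N -> n = m %[mod p] ->
  eqmod_rat p 2 (schenker_q n p) 0 = eqmod_rat p 2 (schenker_q m p) 0.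
Proof.
move=> p_pr pm pa nm.
rewrite !(@schenker_q_deriv p (2 * p)) ?(eqn_mod_schenker_dvd p_pr pm nm) //;
  last exact: eqn_mod_ndvd pm.
apply: dvdz_congr; have [t ->] := eqn_mod_shift nm.
exact: horner_congr.
Qed.

(** * Hensel lifting *)

Lemma schenker_lift (p k N n0 n : nat) (t b : int) : prime p -> (0 < k)%N ->
  ~~ (p %| n0)%N -> (k.+1 * p <= N)%N -> n%:Z = n0%:Z + (p%:Z ^+ k) * t ->
  (trunc_poly N).[n0%:Z] = p%:Z ^+ k * b ->
  (p ^ k.+1 %| schenker n)%N
    = (p%:Z %| b + t * (trunc_poly N)^`().[n0%:Z])%Z.
Proof.
move=> p_pr k0 pn0 kpN En Eb.
have pn : ~~ (p %| n)%N.
  apply: eqn_mod_ndvd pn0; apply: (@eqn_modX1 p k) => //.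
  apply/eqn_mod_dvdz/dvdzP; exists t; rewrite En addrAC subrr add0r.
  by rewrite PoszX_nat mulrC.
have pk0 : p%:Z ^+ k != 0 by rewrite expf_neq0 // eqz_nat -lt0n prime_gt0.
rewrite (@dvdz_schenker_trunc p k.+1 N) // En.
have [c ->] := int_taylor1 (trunc_poly N) n0%:Z (p%:Z ^+ k * t).
rewrite Eb -[RHS](dvdz_mul2l pk0) -exprSr.
(* The quadratic term p^(2k) t^2 c is a multiple of p^(k+1) as k > 0. *)
apply: dvdz_congr; apply/dvdzP; exists (p%:Z ^+ k.-1 * t ^+ 2 * c).
set B := _.[_].
have Ek : p%:Z ^+ k = p%:Z * p%:Z ^+ k.-1 by rewrite -exprS prednK.
by rewrite [p%:Z ^+ k.+1]exprS Ek; ring.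
Qed.

(** The form in which Hensel's argument is used: b and D are P(n0) / p^k and
    P'(n0) for a truncation P of order large enough for modulus p^(k+1). The
    order grows with k, so P is kept hidden, and the divisibility of D by p is
    expressed by q, which involves no truncation. *)
Lemma schenker_hensel (p k n0 : nat) : prime p -> (0 < k)%N ->
  ~~ (p %| n0)%N -> (p ^ k %| schenker n0)%N ->
  exists b D : int,
  [/\ eqmod_rat p 2 (schenker_q n0 p) 0 = (p%:Z %| D)%Z,
      (p ^ k.+1 %| schenker n0)%N = (p%:Z %| b)%Z
    & forall (n : nat) (t : int), n%:Z = n0%:Z + (p%:Z ^+ k) * t ->
       (p ^ k.+1 %| schenker n)%N = (p%:Z %| b + t * D)%Z].
Proof.
move=> p_pr k0 pn0 pa; pose N := (k.+1 * p)%N.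
have kp : (k * p <= N)%N by rewrite leq_mul2r leqnSn orbT.
have /dvdzP[b] : (p%:Z ^+ k %| (trunc_poly N).[n0%:Z])%Z.
  by rewrite -(dvdz_schenker_trunc p_pr pn0 kp).
rewrite mulrC => Eb; exists b, (trunc_poly N)^`().[n0%:Z]; split.
- apply: schenker_q_deriv => //; last by rewrite leq_mul2r ltnS k0 orbT.
  by apply: dvdn_trans pa; apply: dvdn_exp.
- rewrite (@schenker_lift p k N n0 n0 0 b) // ?mul0r ?addr0 //.
  by rewrite mulr0 addr0.
- by move=> n t En; apply: schenker_lift.
Qed.

Lemma schenker_dvd_constant (p k nk m : nat) : prime p -> (0 < k)%N ->
  ~~ (p %| nk)%N -> (p ^ k %| schenker nk)%N ->
  eqmod_rat p 2 (schenker_q nk p) 0 -> m = nk %[mod p ^ k] ->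
  (p ^ k.+1 %| schenker m)%N = (p ^ k.+1 %| schenker nk)%N.
Proof.
move=> p_pr k0 pnk pa.
have [b [D [-> Eb lift]]] := schenker_hensel p_pr k0 pnk pa.
move=> pD /eqn_mod_shift[t Et]; rewrite Eb (lift _ t).
  by rewrite rpredDr // dvdz_mull.
by rewrite Et PoszX_nat.
Qed.

Lemma unique_lift (p k nk : nat) : prime p -> (0 < k)%N -> (0 < nk)%N ->
  ~~ (p %| nk)%N -> (p ^ k %| schenker nk)%N ->
  ~~ eqmod_rat p 2 (schenker_q nk p) 0 ->
  exists m : nat,
    [/\ (0 < m)%N, (p ^ k.+1 %| schenker m)%N, m = nk %[mod p ^ k]
      & forall n : nat, n = nk %[mod p ^ k] ->
          ((p ^ k.+1 %| schenker n)%N <-> n = m %[mod p ^ k.+1])].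
Proof.
move=> p_pr k0 nk0 pnk pa qn.
have [b [D [ED _ lift]]] := schenker_hensel p_pr k0 pnk pa.
rewrite ED in qn.
have cop : coprimez p%:Z D by rewrite coprimezE /= prime_coprime // -dvdzE.
have p0 : p%:Z != 0 by rewrite eqz_nat -lt0n prime_gt0.
have pk0 : p%:Z ^+ k != 0 by rewrite expf_neq0.
have [[u v] /= Euv] := coprimezP _ _ cop.
(* With D v = 1 modulo p, the residue t = - b v solves b + t D = 0 modulo p;
   it is reduced modulo p to be nonnegative, so that nk + p^k t is a positive
   natural number. *)
pose t := (- b * v %% p%:Z)%Z.
have pt : (p%:Z %| b + t * D)%Z.
  have Et := divz_eq (- b * v) p%:Z; rewrite -/t in Et.
  apply/dvdzP; exists (b * u - (- b * v %/ p%:Z)%Z * D).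
  have -> : t = - b * v - (- b * v %/ p%:Z)%Z * p%:Z by rewrite {1}Et addrAC subrr add0r.
  have -> : b + (- b * v - (- b * v %/ p%:Z)%Z * p%:Z) * D
     = b * (1 - v * D) - (- b * v %/ p%:Z)%Z * p%:Z * D by ring.
  by rewrite -Euv; ring.
have Et : (`|t|%N)%:Z = t by rewrite gez0_abs // modz_ge0.
have Em : (nk + p ^ k * `|t|)%N%:Z = nk%:Z + p%:Z ^+ k * t.
  by rewrite PoszD PoszM PoszX_nat Et.
exists (nk + p ^ k * `|t|)%N; split.
- by rewrite addn_gt0 nk0.
- by rewrite (lift _ t).
- by rewrite mulnC addnC modnMDl.
move=> n /eqn_mod_shift[s]; rewrite PoszX_nat => En.
rewrite (lift _ s) //; rewrite eqn_mod_dvdz En Em PoszX_nat.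
have -> : nk%:Z + p%:Z ^+ k * s - (nk%:Z + p%:Z ^+ k * t) = p%:Z ^+ k * (s - t).
  by ring.
rewrite exprSr dvdz_mul2l // -(Gauss_dvdzl _ cop).
rewrite (@dvdz_congr _ (b + s * D) ((s - t) * D)) //.
by have -> : b + s * D - (s - t) * D = b + t * D by ring.
Qed.

(** In the inductive step, a solution modulo p^(k+1) already lies in the class
    found for p^k, so only the lifts of that class compete. *)
Lemma unique_solution (p n1 k : nat) : prime p -> (0 < n1)%N ->
  ~~ (p %| n1)%N -> (p %| schenker n1)%N ->
  ~~ eqmod_rat p 2 (schenker_q n1 p) 0 -> (0 < k)%N ->
  exists m : nat,
    [/\ (0 < m)%N, (p ^ k %| schenker m)%N, m = n1 %[mod p]
      & forall n : nat, n = n1 %[mod p] ->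
          ((p ^ k %| schenker n)%N <-> n = m %[mod p ^ k])].
Proof.
move=> p_pr n10 pn1 pa qn1; elim: k => // -[|k] IH _.
  exists n1; rewrite expn1; split=> // n nn1.
  by rewrite (eqn_mod_schenker_dvd p_pr pn1 nn1) pa nn1.
have [m [m0 pm mn1 uniq_m]] := IH isT.
have [||m' [m'0 pm' m'm uniq_m']] := unique_lift p_pr (ltn0Sn k) m0 _ pm.
- exact: eqn_mod_ndvd pn1.
- by rewrite (eqmod_schenker_q_congr p_pr pn1).
have m'n1 : m' = n1 %[mod p] by rewrite (eqn_modX1 _ m'm).
exists m'; split=> // n nn1; split=> [pan|nm'].
  apply/uniq_m' => //; apply/(uniq_m _ nn1).
  by apply: dvdn_trans pan; rewrite dvdn_exp2l.
have nm'k : n = m' %[mod p ^ k.+1].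
  move/eqn_mod_dvdz: nm' => nm'; apply/eqn_mod_dvdz; apply: dvdz_trans nm'.
  by rewrite dvdzE /= dvdn_exp2l.
by apply/uniq_m' => //; rewrite nm'k.
Qed.

Local Close Scope ring_scope.

Theorem theorem1 (p : nat) (p_prime : prime p) :
  (forall (k nk : nat), 0 < k -> 0 < nk -> ~~ (p %| nk) ->
     p ^ k %| schenker nk ->
     [/\ ~~ eqmod_rat p 2 (schenker_q nk p) 0 ->
           exists m : nat,
             [/\ 0 < m, p ^ k.+1 %| schenker m, m = nk %[mod p ^ k]
               & forall n : nat, 0 < n -> n = nk %[mod p ^ k] ->
                   (p ^ k.+1 %| schenker n <-> n = m %[mod p ^ k.+1])],
         eqmod_rat p 2 (schenker_q nk p) 0 -> p ^ k.+1 %| schenker nk ->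
           forall m : nat, 0 < m -> m = nk %[mod p ^ k] ->
             p ^ k.+1 %| schenker m
       & eqmod_rat p 2 (schenker_q nk p) 0 -> ~~ (p ^ k.+1 %| schenker nk) ->
           forall m : nat, 0 < m -> m = nk %[mod p ^ k] ->
             ~~ (p ^ k.+1 %| schenker m)]) /\
  (forall n1 : nat, 0 < n1 -> ~~ (p %| n1) -> p %| schenker n1 ->
     ~~ eqmod_rat p 2 (schenker_q n1 p) 0 ->
     forall k : nat, 0 < k ->
       exists m : nat,
         [/\ 0 < m, (k%:Z%:E <= padic_val p (schenker m)%:R)%E,
             m = n1 %[mod p]
           & forall n : nat, 0 < n -> n = n1 %[mod p] ->
               ((k%:Z%:E <= padic_val p (schenker n)%:R)%E
                 <-> n = m %[mod p ^ k])]).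
Proof.
split=> [k nk k0 nk0 pnk pa | n1 n10 pn1 pa qn1 k k0].
  split=> [qn | q0 pak m _ mnk | q0 pak m _ mnk].
  - have [m [m0 pm mnk uniq_m]] := unique_lift p_prime k0 nk0 pnk pa qn.
    by exists m; split=> // n _; apply: uniq_m.
  - by rewrite (schenker_dvd_constant p_prime k0 pnk pa q0 mnk).
  - by rewrite (schenker_dvd_constant p_prime k0 pnk pa q0 mnk).
have [m [m0 pm mn1 uniq_m]] := unique_solution p_prime n10 pn1 pa qn1 k0.
exists m; rewrite padic_val_nat_ge //; split=> // n _ nn1.
by rewrite padic_val_nat_ge //; apply: uniq_m.
Qed.
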